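(* Let $R$ be an indecomposable commutative ring, $P$ a set, and $\eta$ a surjective $2$-local automorphism of $\Pi=\prod_{x\in P}Re_x$. Then $\eta$ is an $R$-algebra automorphism.
   Context: A commutative ring $R$ with identity is indecomposable if $0,1$ are its only idempotents. $\Pi=\prod_{x\in P}Re_x$ is the full cartesian product of $|P|$ copies of $R$, an $R$-algebra with componentwise operations. A $2$-local automorphism of $\Pi$ is an $R$-linear map $\eta:\Pi\to\Pi$ such that for all $a_1,a_2\in\Pi$ there is an $R$-algebra automorphism $\varphi$ of $\Pi$ with $\eta(a_1)=\varphi(a_1)$ and $\eta(a_2)=\varphi(a_2)$. *)

(* Defs.v *)
From HB Require Import structures.
From mathcomp Require Import all_boot all_algebra.
From mathcomp Require Import boolp classical_sets functions.

Set Implicit Arguments.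
Unset Strict Implicit.
Unset Printing Implicit Defensive.

Import GRing.Theory.
Local Open Scope ring_scope.

(* The zero ring is allowed: its only idempotent is 0 = 1. *)
Definition indecomposable (R : comPzRingType) : Prop :=
  forall e : R, e * e = e -> e = 0 \/ e = 1.

(* The full product of P copies of R. The regular module R^o makes the
   pointwise operations on P -> R^o a ring and an R-module, with
   (k *: a) x = k * a x. [lalgType] is not used, since algebras there are
   non-trivial, whereas this product is trivial when P is empty or R = 0. *)
Definition full_prod (R : comPzRingType) (P : Type) : Type := P -> R^o.

HB.instance Definition _ (R : comPzRingType) (P : Type) :=
  GRing.ComPzRing.on (full_prod R P).
HB.instance Definition _ (R : comPzRingType) (P : Type) :=
  GRing.Lmodule.on (full_prod R P).

Section Automorphisms.
Variables (R : comPzRingType) (P : Type).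
Implicit Types phi eta : full_prod R P -> full_prod R P.

Definition algebra_automorphism phi : Prop :=
  [/\ linear phi, monoid_morphism phi & bijective phi].

Definition two_local_automorphism eta : Prop :=
  linear eta /\
  forall a1 a2 : full_prod R P, exists phi,
    [/\ algebra_automorphism phi, eta a1 = phi a1 & eta a2 = phi a2].

End Automorphisms.

(* Main.v *)
(* For R nonzero and indecomposable, every idempotent of the product is a 0-1
   function, so an algebra automorphism sends minimal idempotents to minimal
   idempotents. If eta sends the x-th basis idempotent to the y-th one, then
   comparing eta with one automorphism at a and at the x-th basis idempotent
   gives eta a y = a x. Surjectivity of eta makes every y arise from some x, so
   eta is multiplicative coordinate by coordinate. *)
Require Import Defs.
From mathcomp Require Import all_boot all_algebra.
From mathcomp Require Import boolp.

Set Implicit Arguments.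
Unset Strict Implicit.
Unset Printing Implicit Defensive.

Import GRing.Theory.
Local Open Scope ring_scope.

Section BasisIdempotents.
Variables (R : comPzRingType) (P : Type).
Implicit Types (a b : full_prod R P) (phi : full_prod R P -> full_prod R P).

(** The classical test [asbool] is used because [P] is an arbitrary type, with no decidable
    equality. *)
Definition basis_idem (x : P) : full_prod R P := fun y => (`[< x = y >])%:R.

Lemma basis_idem_diag x : basis_idem x x = 1.
Proof. by rewrite /basis_idem asboolT. Qed.

Lemma mul_basis_idem a x : a * basis_idem x = (a x : R) *: basis_idem x.
Proof.
apply/funext => y; change (a y * basis_idem x y = a x * basis_idem x y).
rewrite /basis_idem; case: asboolP => [-> //|_].
by rewrite !mulr0.
Qed.

Lemma basis_idem_idem x : basis_idem x * basis_idem x = basis_idem x.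
Proof. by rewrite mul_basis_idem basis_idem_diag scale1r. Qed.

Lemma idem_coord a : indecomposable R -> a * a = a ->
  forall x, a x = 0 \/ a x = 1.
Proof. by move=> indecR aa x; apply: indecR; exact: (congr1 (@^~ x) aa). Qed.

(** The preimage of [basis_idem y] is a nonzero idempotent, so it takes the value 1 at some index;
    that index is the required [x]. *)
Lemma automorphism_basis_idem_surj phi : indecomposable R ->
  algebra_automorphism phi ->
  forall y, exists x, phi (basis_idem x) = basis_idem y.
Proof.
move=> indecR [philin [_ phiM] [psi phiK psiK]] y.
(* Over the zero ring all functions coincide, so any index serves. *)
have [R0|R1] := eqVneq (1 : R) 0.
  exists y; apply/funext => z.
  by rewrite -[LHS](@mulr1 R) -[RHS](@mulr1 R) R0 !mulr0.
have phi0 : phi 0 = 0.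
  by have := philin (-1) 0 0; rewrite !scaleN1r oppr0 addr0 addNr.
have idem_unit a : a * a = a -> a != 0 -> exists x, a x = 1.
  move=> aa a0; apply: contrapT => no1; case/eqP: a0; apply/funext => x.
  by have [//|ax1] := idem_coord indecR aa x; case: no1; exists x.
have basis0 x : basis_idem x != 0.
  by apply: contra_neq R1 => /(congr1 (@^~ x)); rewrite basis_idem_diag.
pose b := psi (basis_idem y).
have phib : phi b = basis_idem y by rewrite psiK.
have [x bx1] : exists x, b x = 1.
  apply: idem_unit.
    by apply: (can_inj phiK); rewrite phiM phib basis_idem_idem.
  by apply: contra_neq (basis0 y) => b0; rewrite -phib b0 phi0.
exists x.
(* [basis_idem x] lies below [b], so its image lies below [basis_idem y]. *)
have below : phi (basis_idem x) = (phi (basis_idem x) y : R) *: basis_idem y.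
  by rewrite -mul_basis_idem -phib -phiM mulrC mul_basis_idem bx1 scale1r.
have phi_idem : phi (basis_idem x) * phi (basis_idem x) = phi (basis_idem x).
  by rewrite -phiM basis_idem_idem.
(* A coefficient 0 would put the nonzero [basis_idem x] in the kernel of [phi]. *)
have [c0|c1] := idem_coord indecR phi_idem y; last by rewrite below c1 scale1r.
case/eqP: (basis0 x); apply: (can_inj phiK).
by rewrite phi0 below c0 scale0r.
Qed.

(** Apply [phi] to [mul_basis_idem] and read off coordinate [y]. *)
Lemma automorphism_coord phi x y a : algebra_automorphism phi ->
  phi (basis_idem x) = basis_idem y -> phi a y = a x.
Proof.
move=> [philin [_ phiM] [psi phiK _]] phix.
have : phi a * basis_idem y = (a x : R) *: basis_idem y.
  by rewrite -phix -phiM mul_basis_idem (scalable_linear philin).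
move/(congr1 (@^~ y)).
change (phi a y * basis_idem y y = a x * basis_idem y y -> phi a y = a x).
by rewrite basis_idem_diag !mulr1.
Qed.

End BasisIdempotents.

Theorem corollary3p9 (R : comPzRingType) (P : Type)
    (eta : full_prod R P -> full_prod R P)
    (indecR : indecomposable R)
    (eta_2local : two_local_automorphism eta)
    (eta_surj : forall b : full_prod R P, exists a : full_prod R P, eta a = b) :
  algebra_automorphism eta.
Proof.
have [eta_lin eta_loc] := eta_2local.
have eta_inj : injective eta.
  move=> a b eab; have [phi [[_ _ phi_bij] ea eb]] := eta_loc a b.
  by apply: (bij_inj phi_bij); rewrite -ea -eb.
have eta_coord y : exists x, forall a, eta a y = a x.
  have [b eb] := eta_surj (basis_idem R y).
  have [phi [phi_aut eb' _]] := eta_loc b b.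
  have [x phix] := automorphism_basis_idem_surj indecR phi_aut y.
  have bE : b = basis_idem R x.
    have [_ _ phi_bij] := phi_aut.
    by apply: (bij_inj phi_bij); rewrite -eb' eb phix.
  (* The automorphism [psi] varies with [a], but [x] was fixed before [a]. *)
  exists x => a; have [psi [psi_aut ea ex]] := eta_loc a (basis_idem R x).
  by rewrite ea; apply: automorphism_coord psi_aut _; rewrite -ex -bE.
split=> //.
- split=> [|a b]; apply/funext => y; have [x etay] := eta_coord y.
    by rewrite etay.
  by change (eta (a * b) y = eta a y * eta b y); rewrite !etay.
(* By injectivity, a chosen right inverse is two-sided. *)
- have [inv invK] := choice eta_surj.
  by exists inv => // a; apply: eta_inj; rewrite invK.
Qed.
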